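(* Let $\Gamma$ be a finite simplicial graph with right-angled Artin group $A_\Gamma$. The group $\Sigma\mathrm{POut}(A_\Gamma)$ acts on the complex $\mathrm{MM}_\Gamma$ with free abelian (simplex) stabilizers and with fundamental domain the simplicial realization $|\mathrm{Wh}_\Gamma|$ of the $\Gamma$-Whitehead poset, identified with the subcomplex of $\mathrm{MM}_\Gamma$ spanned by the vertices $[V_\Gamma,\mathbf{A}]$, $\mathbf{A}\in\mathrm{Wh}_\Gamma$.
   Context: **Groups.** $\Gamma$ is a finite simplicial graph (no loops, no multiple edges) with vertex set $V_\Gamma$; $A_\Gamma=\langle V_\Gamma \mid [v,w]=1 \text{ for every edge } (v,w)\rangle$. For $a\in V_\Gamma$, $\mathrm{lk}(a)$ is the set of vertices adjacent to $a$ and $\mathrm{st}(a)=\mathrm{lk}(a)\cup\{a\}$; $\Gamma-\mathrm{st}(a)$ is the subgraph induced by the remaining vertices (induced subgraphs are identified with their vertex sets). $\Sigma\mathrm{PAut}(A_\Gamma)$ is the group of automorphisms of $A_\Gamma$ mapping each $v\in V_\Gamma$ to a conjugate of itself, and $\Sigma\mathrm{POut}(A_\Gamma)=\Sigma\mathrm{PAut}(A_\Gamma)/\mathrm{Inn}(A_\Gamma)$. **Based partitions.** A ($\Gamma$-valid) based partition with operative factor $a\in V_\Gamma$ is a partition $\underline{A}_a=\{\{a\},P_1,\dots,P_k\}$ of the set $V_\Gamma-\mathrm{lk}(a)$ such that each $P_i$ (called a petal) is a union of connected components of $\Gamma-\mathrm{st}(a)$. The trivial based partition is the one with only one petal, $\{\{a\},\Gamma-\mathrm{st}(a)\}$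 (if $\mathrm{st}(a)=V_\Gamma$ it is the only based partition at $a$). Two based partitions $\underline{A}_a,\underline{B}_b$ cross if $a\notin\mathrm{st}(b)$ and there are petals $P$ of $\underline{A}_a$ and $Q$ of $\underline{B}_b$ with $a\notin Q$, $b\notin P$ and $P\cap Q\neq\emptyset$. They are compatible if $a\in\mathrm{st}(b)$ or they do not cross. **Vertex types and order.** A ($\Gamma$-)vertex type $\mathbf{A}$ is a collection of $|V_\Gamma|$ pairwise compatible based partitions, one $\underline{A}_a$ with operative factor $a$ for each $a\in V_\Gamma$. For based partitions with the same operative factor, $\underline{A}_a\le\underline{B}_a$ if every petal of $\underline{B}_a$ is contained in a petal of $\underline{A}_a$; for vertex types, $\mathbf{A}\le\mathbf{B}$ if $\underline{A}_a\le\underline{B}_a$ for all $a$. The $\Gamma$-Whitehead poset $\mathrm{Wh}_\Gamma$ is the poset of all vertex types. **Carried automorphisms.** $\alpha\in\Sigma\mathrm{PAut}(A_\Gamma)$ is carried by $\underline{A}_a$ if $\alpha$ fixes $a$ and every vertex of $\mathrm{lk}(a)$, conjugates every $b\in V_\Gamma-\mathrm{st}(a)$ by a power of $a$, and conjugates vertices lying in the same petal by the same power. $\alpha$ is carried by a vertex type $\mathbf{A}$ if it is a product of automorphisms each carried by some based partition of $\mathbf{A}$. **The complex.** A basis of $A_\Gamma$ is an ordered generating set $X=\alpha(V_\Gamma)$ with $\alpha\in\Sigma\mathrm{PAut}(A_\Gamma)$. A marked vertex type is a pair $(X,\mathbf{A})$ of a basis and a vertex type. It carries $\alpha$ if $\gamma\alpha\gamma^{-1}$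 is carried by $\mathbf{A}$, where $\gamma\in\Sigma\mathrm{PAut}(A_\Gamma)$ and $\gamma(X)=V_\Gamma$. Two marked vertex types $(X_1,\mathbf{A}),(X_2,\mathbf{A})$ are equivalent if there is $\alpha$ carried by $(X_1,\mathbf{A})$ with $\alpha(X_1)=X_2$; $[X,\mathbf{A}]$ denotes the equivalence class. The order $(X,\mathbf{A})\le(X,\mathbf{B})$ iff $\mathbf{A}\le\mathbf{B}$ (same marking) induces a partial order on the set of classes, and $\mathrm{MM}_\Gamma$ is the simplicial realization (order complex) of this poset. The action is $\alpha\cdot[X,\mathbf{A}]=[\alpha(X),\mathbf{A}]$ for $\alpha\in\Sigma\mathrm{PAut}(A_\Gamma)$; inner automorphisms act trivially, so it is an action of $\Sigma\mathrm{POut}(A_\Gamma)$. **Fundamental domain** means a subcomplex containing exactly one point of each orbit (strong fundamental domain). *)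

(* Defs.v *)
From HB Require Import structures.
From mathcomp Require Import all_boot all_order all_algebra.
From mathcomp Require Import generic_quotient.
From mathcomp Require Import boolp.

Set Implicit Arguments.
Unset Strict Implicit.
Unset Printing Implicit Defensive.

Import Order.TTheory.

Local Open Scope group_scope.
Local Open Scope quotient_scope.

Record sgraph := SGraph {
  vertex :> finType;
  adj : rel vertex;
  adj_sym : symmetric adj;
  adj_irr : irreflexive adj }.

Arguments adj {s} : rename.

Section RAAG.
Variable G : sgraph.

(* The letter (v, true) stands for v and (v, false) for v^-1. *)
Definition letter := (G * bool)%type.
Definition word := seq letter.
Definition linv (x : letter) : letter := (x.1, ~~ x.2).
Definition winv (w : word) : word := rev (map linv w).

Inductive raag_eq : word -> word -> Prop :=
| raag_eq_refl u : raag_eq u u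
| raag_eq_sym u v : raag_eq u v -> raag_eq v u
| raag_eq_trans u v w : raag_eq u v -> raag_eq v w -> raag_eq u w
| raag_eq_cancel u w x : raag_eq (u ++ [:: x, linv x & w]) (u ++ w)
| raag_eq_comm u w (a b : G) : adj a b ->
    raag_eq (u ++ [:: (a, true), (b, true) & w])
            (u ++ [:: (b, true), (a, true) & w]).

Definition raag_rel (u v : word) : bool := `[< raag_eq u v >].

Fact raag_rel_refl : reflexive raag_rel.
Proof. by move=> u; apply/asboolP; constructor. Qed.
Fact raag_rel_sym : symmetric raag_rel.
Proof. by move=> u v; apply: asbool_equiv_eq; split; apply: raag_eq_sym. Qed.
Fact raag_rel_trans : transitive raag_rel.
Proof.
by move=> v u w /asboolP uv /asboolP vw; apply/asboolP; apply: raag_eq_trans vw.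
Qed.
Canonical raag_equiv :=
  EquivRel raag_rel raag_rel_refl raag_rel_sym raag_rel_trans.

Definition raag := {eq_quot raag_rel}.
HB.instance Definition _ := Choice.on raag.
HB.instance Definition _ := EqQuotient.on raag.

Fact raag_piP (u v : word) : raag_eq u v <-> \pi_raag u = \pi_raag v.
Proof.
split; first by move=> uv; apply/eqmodP/asboolP.
by move/eqmodP/asboolP.
Qed.

Fact raag_eq_cat2l s u v : raag_eq u v -> raag_eq (s ++ u) (s ++ v).
Proof.
elim=> {u v} [u|u v _|u v w _ + _|u w x|u w a b ab].
- by constructor.
- exact: raag_eq_sym.
- exact: raag_eq_trans.
- by rewrite !catA; constructor.
- by rewrite !catA; constructor.
Qed.

Fact raag_eq_cat2r s u v : raag_eq u v -> raag_eq (u ++ s) (v ++ s).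
Proof.
elim=> {u v} [u|u v _|u v w _ + _|u w x|u w a b ab].
- by constructor.
- exact: raag_eq_sym.
- exact: raag_eq_trans.
- by rewrite -!catA /=; constructor.
- by rewrite -!catA /=; constructor.
Qed.

Fact raag_eq_cat u u' v v' :
  raag_eq u u' -> raag_eq v v' -> raag_eq (u ++ v) (u' ++ v').
Proof.
by move=> uu vv; apply: raag_eq_trans (raag_eq_cat2r _ uu) (raag_eq_cat2l _ vv).
Qed.

Fact linvK : involutive linv.
Proof. by case=> v b; rewrite /linv /= negbK. Qed.

Fact winvK : involutive winv.
Proof. by move=> w; rewrite /winv map_rev revK (mapK linvK). Qed.

Fact raag_eq_winvr w : raag_eq (w ++ winv w) [::].
Proof.
elim/last_ind: w => [|w x IH]; first by constructor.
rewrite /winv map_rcons rev_rcons cat_rcons.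
by apply: raag_eq_trans IH; constructor.
Qed.

Fact raag_eq_winvl w : raag_eq (winv w ++ w) [::].
Proof. by rewrite -{2}[w]winvK; apply: raag_eq_winvr. Qed.

Fact raag_eq_winv u v : raag_eq u v -> raag_eq (winv u) (winv v).
Proof.
move=> uv; apply: (@raag_eq_trans _ (winv u ++ (v ++ winv v))).
  rewrite -{1}[winv u]cats0; apply/raag_eq_cat2l/raag_eq_sym.
  exact: raag_eq_winvr.
rewrite catA -[X in raag_eq _ X]cat0s; apply: raag_eq_cat2r.
apply: raag_eq_trans (raag_eq_winvl u).
by apply: raag_eq_cat2l; apply: raag_eq_sym.
Qed.

Definition raag_one : raag := \pi_raag [::].
Definition raag_mul (x y : raag) : raag := \pi_raag (repr x ++ repr y).
Definition raag_inv (x : raag) : raag := \pi_raag (winv (repr x)).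

Fact repr_raag w : raag_eq (repr (\pi_raag w)) w.
Proof. by apply/raag_piP; rewrite reprK. Qed.

Fact raag_mulE u v : raag_mul (\pi_raag u) (\pi_raag v) = \pi_raag (u ++ v).
Proof. by apply/raag_piP; apply: raag_eq_cat; apply: repr_raag. Qed.
Fact raag_invE u : raag_inv (\pi_raag u) = \pi_raag (winv u).
Proof. by apply/raag_piP; apply: raag_eq_winv; apply: repr_raag. Qed.

Fact raag_mulA : associative raag_mul.
Proof.
elim/quotW=> u; elim/quotW=> v; elim/quotW=> w.
by rewrite (raag_mulE v w) (raag_mulE u v) !raag_mulE catA.
Qed.
Fact raag_mul1 : left_id raag_one raag_mul.
Proof. by elim/quotW=> u; rewrite raag_mulE. Qed.
Fact raag_1mul : right_id raag_one raag_mul.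
Proof. by elim/quotW=> u; rewrite raag_mulE cats0. Qed.
Fact raag_mulV : left_inverse raag_one raag_inv raag_mul.
Proof.
elim/quotW=> u; rewrite raag_invE raag_mulE.
by apply/raag_piP; apply: raag_eq_winvl.
Qed.
Fact raag_Vmul : right_inverse raag_one raag_inv raag_mul.
Proof.
elim/quotW=> u; rewrite raag_invE raag_mulE.
by apply/raag_piP; apply: raag_eq_winvr.
Qed.

HB.instance Definition _ :=
  isGroup.Build raag raag_mulA raag_mul1 raag_1mul raag_mulV raag_Vmul.

Definition gen (v : G) : raag := \pi_raag [:: (v, true)].

End RAAG.

Definition zexpg (H : groupType) (x : H) (n : int) : H :=
  match n with Posz k => x ^+ k | Negz k => x ^- k.+1 end.

Section Aut.
Variable H : groupType.

Record aut := Aut {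
  aut_fun :> H -> H;
  aut_morph : {morph aut_fun : x y / x * y};
  aut_bij : bijective aut_fun }.

Fact aut_eqP (f g : aut) : f =1 g -> f = g.
Proof.
case: f g => [f fM fB] [g gM gB] /= /funext fg; subst g.
by rewrite (Prop_irrelevance fM gM) (Prop_irrelevance fB gB).
Qed.

HB.instance Definition _ := gen_eqMixin aut.
HB.instance Definition _ := gen_choiceMixin aut.

Definition aut_one : aut :=
  @Aut id (fun _ _ => erefl) (Bijective (fun _ => erefl) (fun _ => erefl)).

Fact aut_mul_morph (f g : aut) : {morph f \o g : x y / x * y}.
Proof. by move=> x y /=; rewrite !aut_morph. Qed.
Definition aut_mul (f g : aut) : aut :=
  Aut (@aut_mul_morph f g) (bij_comp (aut_bij f) (aut_bij g)).

Fact aut_inv_subproof (f : aut) : exists g : aut, cancel f g /\ cancel g f.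
Proof.
have [g fK gK] := aut_bij f.
have gM : {morph g : x y / x * y}.
  by move=> x y; apply: (can_inj fK); rewrite aut_morph !gK.
by exists (Aut gM (Bijective gK fK)).
Qed.
Definition aut_inv (f : aut) : aut := projT1 (cid (aut_inv_subproof f)).

Fact aut_invK (f : aut) : cancel f (aut_inv f).
Proof. by rewrite /aut_inv; case: cid => g []. Qed.
Fact aut_Kinv (f : aut) : cancel (aut_inv f) f.
Proof. by rewrite /aut_inv; case: cid => g []. Qed.

Fact aut_mulA : associative aut_mul. Proof. by move=> f g h; apply/aut_eqP. Qed.
Fact aut_mul1 : left_id aut_one aut_mul.
Proof. by move=> f; apply/aut_eqP. Qed.
Fact aut_1mul : right_id aut_one aut_mul.
Proof. by move=> f; apply/aut_eqP. Qed.
Fact aut_mulV : left_inverse aut_one aut_inv aut_mul.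
Proof. by move=> f; apply/aut_eqP => x /=; rewrite aut_invK. Qed.
Fact aut_Vmul : right_inverse aut_one aut_inv aut_mul.
Proof. by move=> f; apply/aut_eqP => x /=; rewrite aut_Kinv. Qed.

HB.instance Definition _ :=
  isGroup.Build aut aut_mulA aut_mul1 aut_1mul aut_mulV aut_Vmul.

Fact aut1 (f : aut) : f 1 = 1.
Proof. by apply: (@mulgI _ (f 1)); rewrite -aut_morph !mulg1. Qed.
Fact autV (f : aut) x : f x^-1 = (f x)^-1.
Proof. by apply: (@mulgI _ (f x)); rewrite -aut_morph !mulgV aut1. Qed.
Fact autJ (f : aut) x y : f (x ^ y) = f x ^ f y.
Proof. by rewrite /conjg !aut_morph autV. Qed.

End Aut.

Section PureSymmetric.
Variable G : sgraph.

Definition pure_symmetric : pred (aut (raag G)) := fun f =>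
  `[< forall v : G, exists g : raag G, f (gen v) = gen v ^ g >].

Fact pure_symmetric_closed : group_closed pure_symmetric.
Proof.
split=> [|f g /asboolP Pf /asboolP Pg]; apply/asboolP => v.
  by exists 1; rewrite conjg1.
have [x fv] := Pf v.
have [y gv] : exists y, g^-1 (gen v) = gen v ^ y.
  have [y gv] := Pg v; exists (g^-1 y)^-1.
  rewrite -[gen v in RHS](aut_invK g) gv autJ.
  by rewrite conjgK.
by exists (x * f y); rewrite /= [aut_fun _ _]/= gv autJ fv conjgM.
Qed.

Record SPAut := MkSPAut {
  spaut_aut :> aut (raag G);
  spautP : pure_symmetric spaut_aut }.
HB.instance Definition _ := [isSub for spaut_aut].
HB.instance Definition _ := [Choice of SPAut by <:].
HB.instance Definition _ :=
  SubChoice_isSubGroup.Build _ pure_symmetric SPAut pure_symmetric_closed.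

Fact spaut_eqP (f g : SPAut) : f =1 g -> f = g.
Proof. by move=> fg; apply/val_inj/aut_eqP. Qed.
Fact spaut1E (x : raag G) : (1 : SPAut) x = x. Proof. by []. Qed.
Fact spautME (f g : SPAut) x : (f * g) x = f (g x). Proof. by []. Qed.
Fact spautK (f : SPAut) : cancel f f^-1. Proof. exact: aut_invK. Qed.
Fact spautVK (f : SPAut) : cancel f^-1 f. Proof. exact: aut_Kinv. Qed.

Definition is_inner (f : SPAut) : Prop :=
  exists g : raag G, forall x, f x = x ^ g.

Fact is_inner1 : is_inner 1.
Proof. by exists 1 => x; rewrite conjg1. Qed.
Fact is_innerM f g : is_inner f -> is_inner g -> is_inner (f * g).
Proof.
move=> [x fx] [y gy]; exists (y * x) => z.
by rewrite spautME gy fx conjgM.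
Qed.
Fact is_innerV f : is_inner f -> is_inner f^-1.
Proof.
move=> [x fx]; exists x^-1 => z.
by rewrite -[z in RHS](spautVK f) fx conjgK.
Qed.
Fact is_innerJ f g : is_inner f -> is_inner (g^-1 * f * g).
Proof.
move=> [x fx]; exists (g^-1 x) => z.
by rewrite !spautME fx autJ spautK.
Qed.

Definition out_rel (f g : SPAut) : bool := `[< is_inner (f^-1 * g) >].

Fact out_rel_refl : reflexive out_rel.
Proof. by move=> f; apply/asboolP; rewrite mulVg; apply: is_inner1. Qed.
Fact out_rel_sym : symmetric out_rel.
Proof.
by move=> f g; apply: asbool_equiv_eq; split=> /is_innerV; rewrite invgM invgK.
Qed.
Fact out_rel_trans : transitive out_rel.
Proof.
move=> g f h /asboolP fg /asboolP gh; apply/asboolP.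
by have := is_innerM fg gh; rewrite mulgA mulgK.
Qed.
Canonical out_equiv := EquivRel out_rel out_rel_refl out_rel_sym out_rel_trans.

Definition SPOut := {eq_quot out_rel}.
HB.instance Definition _ := Choice.on SPOut.
HB.instance Definition _ := EqQuotient.on SPOut.

Fact out_piP f g : is_inner (f^-1 * g) <-> \pi_SPOut f = \pi_SPOut g.
Proof.
split; first by move=> fg; apply/eqmodP/asboolP.
by move/eqmodP/asboolP.
Qed.
Fact repr_out f : is_inner ((repr (\pi_SPOut f))^-1 * f).
Proof. by apply/out_piP; rewrite reprK. Qed.

Definition out_one : SPOut := \pi_SPOut 1.
Definition out_mul (x y : SPOut) : SPOut := \pi_SPOut (repr x * repr y).
Definition out_inv (x : SPOut) : SPOut := \pi_SPOut (repr x)^-1.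

Fact out_mulE f g : out_mul (\pi_SPOut f) (\pi_SPOut g) = \pi_SPOut (f * g).
Proof.
apply/out_piP.
have := is_innerM (is_innerJ (repr (\pi_SPOut g)) (repr_out f)) (repr_out g).
by rewrite invgM !mulgA mulgK.
Qed.
Fact out_invE f : out_inv (\pi_SPOut f) = \pi_SPOut f^-1.
Proof.
apply/out_piP; have := is_innerV (is_innerJ f^-1 (repr_out f)).
by rewrite [(f^-1)^-1]invgK mulgA mulgK invgM.
Qed.

Fact out_mulA : associative out_mul.
Proof.
elim/quotW=> u; elim/quotW=> v; elim/quotW=> w.
by rewrite (out_mulE v w) (out_mulE u v) !out_mulE mulgA.
Qed.
Fact out_mul1 : left_id out_one out_mul.
Proof. by elim/quotW=> u; rewrite out_mulE mul1g. Qed.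
Fact out_1mul : right_id out_one out_mul.
Proof. by elim/quotW=> u; rewrite out_mulE mulg1. Qed.
Fact out_mulV : left_inverse out_one out_inv out_mul.
Proof. by elim/quotW=> u; rewrite out_invE out_mulE mulVg. Qed.
Fact out_Vmul : right_inverse out_one out_inv out_mul.
Proof. by elim/quotW=> u; rewrite out_invE out_mulE mulgV. Qed.

HB.instance Definition _ :=
  isGroup.Build SPOut out_mulA out_mul1 out_1mul out_mulV out_Vmul.

End PureSymmetric.

Section BasedPartitions.
Variable G : sgraph.
Implicit Types (a b : G) (P Q : {set G}) (A B : {set {set G}}).

Definition lk a : {set G} := [set b | adj a b].
Definition st a : {set G} := a |: lk a.

Definition adj_off_st a : rel G :=
  [rel x y | [&& x \notin st a, y \notin st a & adj x y]].
Definition components_off_st a : {set {set G}} :=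
  equivalence_partition (connect (adj_off_st a)) (~: st a).

(* Gamma-validity: P is the union of some set of connected components. *)
Definition component_union a P : bool :=
  [exists C : {set {set G}}, (C \subset components_off_st a) && (P == cover C)].

Definition petals a A : {set {set G}} := A :\ [set a].

Definition based_partition a A : bool :=
  [&& partition A (~: lk a), [set a] \in A &
      [forall P in petals a A, component_union a P]].

Definition cross a A b B : bool :=
  (a \notin st b) &&
  [exists P in petals a A, exists Q in petals b B,
    [&& a \notin Q, b \notin P & P :&: Q != set0]].

Definition compatible a A b B : bool := (a \in st b) || ~~ cross a A b B.

Definition vertex_type_pred (T : {ffun G -> {set {set G}}}) : bool :=
  [forall a, based_partition a (T a)] &&
  [forall a, forall b, compatible a (T a) b (T b)].

Record vertex_type := VertexType {
  vt_fun :> {ffun G -> {set {set G}}};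
  vt_valid : vertex_type_pred vt_fun }.
HB.instance Definition _ := [isSub for vt_fun].
HB.instance Definition _ := [Finite of vertex_type by <:].

Definition bp_le a A B : bool :=
  [forall Q in petals a B, exists P in petals a A, Q \subset P].
Definition vt_le (T U : vertex_type) : bool :=
  [forall a, bp_le a (T a) (U a)].

Fact bp_le_refl a : reflexive (bp_le a).
Proof.
move=> A; apply/forall_inP => P PA.
by apply/exists_inP; exists P.
Qed.
Fact bp_le_trans a : transitive (bp_le a).
Proof.
move=> B A C /forall_inP AB /forall_inP BC; apply/forall_inP => R /BC.
case/exists_inP=> Q /AB /exists_inP[P PA QP] RQ.
by apply/exists_inP; exists P => //; apply: subset_trans QP.
Qed.
Fact bp_le_petals a A B : based_partition a A -> based_partition a B ->
  bp_le a A B -> bp_le a B A -> petals a A \subset petals a B.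
Proof.
move=> /and3P[pA _ _] _ /forall_inP AB /forall_inP BA.
apply/subsetP=> P PA; have /exists_inP[Q QB PQ] := BA _ PA.
have /exists_inP[P' P'A QP'] := AB _ QB.
have PP' := subset_trans PQ QP'.
have [_ tA n0] := and3P pA.
have [PinA P'inA] : P \in A /\ P' \in A.
  by move: PA P'A; rewrite !inE => /andP[_ ->] /andP[_ ->].
suff eP : P' = P.
  by rewrite eP in QP'; have -> : P = Q by apply/eqP; rewrite eqEsubset PQ QP'.
apply: contraNeq n0 => neq; have := trivIsetP tA _ _ P'inA PinA neq.
by rewrite disjoint_sym => /disjoint_setI0; rewrite (setIidPl PP') => <-.
Qed.
Fact bp_le_anti a A B : based_partition a A -> based_partition a B ->
  bp_le a A B -> bp_le a B A -> A = B.
Proof.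
move=> vA vB AB BA.
have /and3P[_ aA _] := vA; have /and3P[_ aB _] := vB.
rewrite -(setD1K aA) -(setD1K aB); congr (_ |: _); apply/eqP.
by rewrite eqEsubset (bp_le_petals vA vB AB BA) (bp_le_petals vB vA BA AB).
Qed.

Fact vt_based (T : vertex_type) a : based_partition a (T a).
Proof. by case: T => T /= /andP[/forallP]. Qed.

Fact vt_le_refl : reflexive vt_le.
Proof. by move=> T; apply/forallP=> a; apply: bp_le_refl. Qed.
Fact vt_le_anti : antisymmetric vt_le.
Proof.
move=> T U /andP[/forallP TU /forallP UT]; apply/val_inj/ffunP=> a.
exact: bp_le_anti (vt_based T a) (vt_based U a) (TU a) (UT a).
Qed.
Fact vt_le_trans : transitive vt_le.
Proof.
move=> U T S /forallP TU /forallP US; apply/forallP=> a.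
exact: bp_le_trans (TU a) (US a).
Qed.

HB.instance Definition _ := Order.Le_isPOrder.Build
  (Order.Disp tt tt) vertex_type vt_le_refl vt_le_anti vt_le_trans.

End BasedPartitions.

Section Carried.
Variable G : sgraph.
Implicit Types (a b : G) (f g h : SPAut G) (T U : vertex_type G).

Definition bp_carries a (A : {set {set G}}) f : Prop :=
  exists p : G -> int,
    [/\ forall b, b \in st a -> f (gen b) = gen b,
        forall b, b \notin st a -> f (gen b) = gen b ^ zexpg (gen a) (p b) &
        forall P b c, P \in petals a A -> b \in P -> c \in P -> p b = p c].

Definition vt_carries T f : Prop :=
  exists2 s : seq (SPAut G),
    (forall g, g \in s -> exists a, bp_carries a (T a) g) &
    f = \prod_(g <- s) g.

Fact zexpgN (H : groupType) (x : H) n : zexpg x (- n)%R = (zexpg x n)^-1.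
Proof. by case: n => [[|n]|n] /=; rewrite ?invg1 ?invgK. Qed.

Fact bp_carries1 a A : bp_carries a A 1.
Proof.
by exists (fun=> 0%R); split=> // b _; rewrite spaut1E /= conjg1.
Qed.

Fact bp_carriesV a A f : bp_carries a A f -> bp_carries a A f^-1.
Proof.
case=> p [fst fnst pc]; exists (fun b => (- p b)%R); split.
- by move=> b /fst fb; rewrite -{1}fb spautK.
- move=> b nb; rewrite zexpgN; apply: (can_inj (spautK f)).
  rewrite spautVK autJ autV fnst //.
  suff -> : f (zexpg (gen a) (p b)) = zexpg (gen a) (p b) by rewrite conjgK.
  have fa : f (gen a) = gen a by apply: fst; rewrite !inE eqxx.
  have fX n : f (gen a ^+ n) = gen a ^+ n.
    by elim: n => [|n IH]; rewrite ?expg0 ?aut1 // expgS aut_morph fa IH.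
  by case: (p b) => n; rewrite /= ?autV fX.
- by move=> P b c PA bP cP; rewrite (pc P b c).
Qed.

Fact bp_carries_le a A B f :
  bp_le a A B -> bp_carries a A f -> bp_carries a B f.
Proof.
move=> /forall_inP AB [p [fst fnst pc]]; exists p; split=> // Q b c /AB.
by case/exists_inP=> P PA /subsetP QP /QP bP /QP cP; apply: pc bP cP.
Qed.

Fact vt_carries1 T : vt_carries T 1.
Proof. by exists [::]; rewrite ?big_nil. Qed.
Fact vt_carriesM T f g : vt_carries T f -> vt_carries T g -> vt_carries T (f * g).
Proof.
move=> [s Ps ->] [t Pt ->]; exists (s ++ t); last by rewrite big_cat.
by move=> h; rewrite mem_cat => /orP[/Ps|/Pt].
Qed.
Fact vt_carries_bp T f a : bp_carries a (T a) f -> vt_carries T f.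
Proof.
move=> fc; exists [:: f]; last by rewrite big_seq1.
by move=> g; rewrite inE => /eqP->; exists a.
Qed.
Fact vt_carriesV T f : vt_carries T f -> vt_carries T f^-1.
Proof.
case=> s + ->; elim: s => [|g s IH] Ps.
  by rewrite big_nil invg1; apply: vt_carries1.
rewrite big_cons invgM; apply: vt_carriesM.
  by apply: IH => h hs; apply: Ps; rewrite inE hs orbT.
have [|a ga] := Ps g; first by rewrite inE eqxx.
exact: vt_carries_bp (bp_carriesV ga).
Qed.
Fact vt_carries_le T U f : (T <= U)%O -> vt_carries T f -> vt_carries U f.
Proof.
move=> /forallP TU [s Ps ->]; exists s => // g /Ps[a ga]; exists a.
exact: bp_carries_le (TU a) ga.
Qed.

Fact gen_ind (P : raag G -> Prop) : P 1 ->
  (forall v x, P x -> P (gen v * x)) ->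
  (forall v x, P x -> P ((gen v)^-1 * x)) -> forall x, P x.
Proof.
move=> P1 Pg PV; elim/quotW; elim=> [|[v b] w IH] //.
case: b; [have := Pg v _ IH | have := PV v _ IH]; congr P.
  exact: (raag_mulE [:: (v, true)] w).
rewrite (_ : (gen v)^-1 = \pi_(raag G) [:: (v, false)]).
  exact: (raag_mulE [:: (v, false)] w).
exact: (raag_invE [:: (v, true)]).
Qed.

Fact spaut_gen f g : (forall v, f (gen v) = g (gen v)) -> f = g.
Proof.
move=> fg; apply: spaut_eqP; elim/gen_ind => [|v x IH|v x IH].
- by rewrite !aut1.
- by rewrite !aut_morph fg IH.
- by rewrite !aut_morph !autV fg IH.
Qed.

Fact gen_adj a b : adj a b -> gen a * gen b = gen b * gen a.
Proof.
move=> ab; have mE u v : \pi_(raag G) u * \pi_(raag G) v = \pi_(raag G) (u ++ v).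
  exact: raag_mulE.
by rewrite !mE; apply/raag_piP; apply: (raag_eq_comm [::] [::] ab).
Qed.

Fact inn_subproof (x : raag G) : exists f, forall y, f y = y ^ x.
Proof.
have xM : {morph (fun y => y ^ x) : y z / y * z}.
  by move=> y z; rewrite conjMg.
have xB : bijective (fun y => y ^ x).
  by exists (fun y => y ^ x^-1) => y; rewrite ?conjgK ?conjgKV.
have xP : pure_symmetric (Aut xM xB) by apply/asboolP => v; exists x.
by exists (MkSPAut xP).
Qed.

Fact vt_carries_inner T f : is_inner f -> vt_carries T f.
Proof.
case=> x; elim/gen_ind: x f => [f f1|v x IH f fv|v x IH f fv].
- by rewrite (_ : f = 1); [apply: vt_carries1 | apply: spaut_eqP => y; rewrite f1 conjg1].
- have [g gx] := inn_subproof x; have [h hv] := inn_subproof (gen v).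
  rewrite (_ : f = g * h); last first.
    by apply: spaut_eqP => y; rewrite spautME fv gx hv conjgM.
  apply: vt_carriesM; [exact: IH | apply: (@vt_carries_bp _ _ v)].
  exists (fun=> Posz 1); split=> // b.
  rewrite !inE hv => /orP[/eqP->|vb]; rewrite /conjg.
    by rewrite mulgA mulVg mul1g.
  by rewrite -(gen_adj vb) mulgA mulVg mul1g.
- have [g gx] := inn_subproof x; have [h hv] := inn_subproof (gen v)^-1.
  rewrite (_ : f = g * h); last first.
    by apply: spaut_eqP => y; rewrite spautME fv gx hv conjgM.
  apply: vt_carriesM; [exact: IH | apply: (@vt_carries_bp _ _ v)].
  exists (fun=> Negz 0); split=> // b.
  rewrite !inE hv => /orP[/eqP->|vb]; rewrite /conjg invgK.
    by rewrite mulgV mulg1.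
  by rewrite mulgA (gen_adj vb) mulgK.
Qed.

End Carried.

Section MarkedVertexTypes.
Variable G : sgraph.
Implicit Types (f g h : SPAut G) (T U : vertex_type G).

(* A basis is ordered: it is recorded as the family (alpha v) indexed by the *)
(* vertices v.                                                               *)
Definition basis_pred (X : {ffun G -> raag G}) : bool :=
  `[< exists f : SPAut G, forall v, X v = f (gen v) >].

Record basis := Basis {
  basis_fun :> {ffun G -> raag G};
  basisP : basis_pred basis_fun }.
HB.instance Definition _ := [isSub for basis_fun].
HB.instance Definition _ := [Choice of basis by <:].
Implicit Types X Y Z : basis.

Fact std_basis_subproof : basis_pred [ffun v => gen v].
Proof. by apply/asboolP; exists 1 => v; rewrite ffunE. Qed.
Definition std_basis : basis := Basis std_basis_subproof.

Fact act_basis_subproof f X : basis_pred [ffun v => f (X v)].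
Proof.
have /asboolP[g Xg] := basisP X; apply/asboolP; exists (f * g) => v.
by rewrite ffunE Xg spautME.
Qed.
Definition act_basis f X : basis := Basis (act_basis_subproof f X).

Fact act_basisM f g X : act_basis (f * g) X = act_basis f (act_basis g X).
Proof. by apply/val_inj/ffunP => v; rewrite !ffunE. Qed.
Fact act_basis1 X : act_basis 1 X = X.
Proof. by apply/val_inj/ffunP => v; rewrite !ffunE. Qed.
Fact basis_std X : exists f, X = act_basis f std_basis.
Proof.
have /asboolP[f Xf] := basisP X; exists f.
by apply/val_inj/ffunP => v; rewrite !ffunE /= Xf.
Qed.
Fact act_basis_inj f g :
  act_basis f std_basis = act_basis g std_basis -> f = g.
Proof.
move=> fg; apply: spaut_gen => v.
by have := congr1 (fun X : basis => X v) fg; rewrite !ffunE.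
Qed.

Definition mvt := (basis * vertex_type G)%type.

Definition mvt_carries (m : mvt) f : Prop :=
  exists2 h, act_basis h m.1 = std_basis & vt_carries m.2 (h * f * h^-1).

Definition mvt_equiv (m n : mvt) : Prop :=
  m.2 = n.2 /\ exists2 f, mvt_carries m f & act_basis f m.1 = n.1.

Fact mvt_equivP f g T U :
  mvt_equiv (act_basis f std_basis, T) (act_basis g std_basis, U) <->
  T = U /\ vt_carries T (f^-1 * g).
Proof.
split=> [[/= <-] [k [h hf c] kf]|[/= <- c]].
  split=> //; rewrite -act_basisM in kf; move/act_basis_inj: kf => <-.
  have -> : f = h^-1.
    apply: act_basis_inj; rewrite -[in RHS]hf -act_basisM mulVg.
    by rewrite act_basis1.
  by rewrite invgK mulgA.
split=> //; exists (g * f^-1); last by rewrite -act_basisM mulgVK.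
exists f^-1; first by rewrite -act_basisM mulVg act_basis1.
by rewrite /= invgK mulgA mulgVK.
Qed.

Definition mvt_rel (m n : mvt) : bool := `[< mvt_equiv m n >].

Fact mvt_rel_refl : reflexive mvt_rel.
Proof.
case=> X T; have [f ->] := basis_std X.
by apply/asboolP/mvt_equivP; rewrite mulVg; split; last exact: vt_carries1.
Qed.
Fact mvt_equiv_sym m n : mvt_equiv m n -> mvt_equiv n m.
Proof.
case: m n => [X T] [Y U].
have [f ->] := basis_std X; have [g ->] := basis_std Y.
move=> /mvt_equivP[-> /vt_carriesV c]; apply/mvt_equivP; split=> //.
by rewrite invgM invgK in c.
Qed.
Fact mvt_rel_sym : symmetric mvt_rel.
Proof. by move=> m n; apply: asbool_equiv_eq; split; apply: mvt_equiv_sym. Qed.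
Fact mvt_rel_trans : transitive mvt_rel.
Proof.
case=> Y U [X T] [Z S].
have [f ->] := basis_std X; have [g ->] := basis_std Y.
have [h ->] := basis_std Z.
move=> /asboolP/mvt_equivP[-> c] /asboolP/mvt_equivP[<- d].
apply/asboolP/mvt_equivP; split=> //.
by have := vt_carriesM c d; rewrite mulgA mulgK.
Qed.
Canonical mvt_equiv_rel :=
  EquivRel mvt_rel mvt_rel_refl mvt_rel_sym mvt_rel_trans.

Definition MM := {eq_quot mvt_rel}.
HB.instance Definition _ := Choice.on MM.
HB.instance Definition _ := EqQuotient.on MM.

Definition mm_class X T : MM := \pi_MM (X, T).

Fact mm_classP f g T U :
  mm_class (act_basis f std_basis) T = mm_class (act_basis g std_basis) U <->
  T = U /\ vt_carries T (f^-1 * g).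
Proof.
split; first by move/eqmodP/asboolP/mvt_equivP.
by move/mvt_equivP => e; apply/eqmodP/asboolP.
Qed.

Fact mm_ind (P : MM -> Prop) :
  (forall f T, P (mm_class (act_basis f std_basis) T)) -> forall c, P c.
Proof.
by move=> Pf; elim/quotW=> [[X T]]; have [f ->] := basis_std X; apply: Pf.
Qed.

Definition mm_le (c d : MM) : bool :=
  `[< exists X T U, [/\ c = mm_class X T, d = mm_class X U & (T <= U)%O] >].

Fact mm_leP f g T U :
  mm_le (mm_class (act_basis f std_basis) T) (mm_class (act_basis g std_basis) U)
  <-> (T <= U)%O /\ vt_carries U (f^-1 * g).
Proof.
split.
  case/asboolP=> X [T' [U' []]]; have [h ->] := basis_std X.
  move=> /mm_classP[<- c] /mm_classP[<- d] TU; split=> //.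
  have := vt_carriesM (vt_carries_le TU c) (vt_carriesV d).
  by rewrite invgM invgK mulgA mulgK.
move=> [TU c]; apply/asboolP.
exists (act_basis f std_basis), T, U; split=> //.
apply/mm_classP; split=> //.
by have := vt_carriesV c; rewrite invgM invgK.
Qed.

Fact mm_le_refl : reflexive mm_le.
Proof.
elim/mm_ind=> f T; apply/mm_leP; rewrite mulVg; split=> //.
exact: vt_carries1.
Qed.
Fact mm_le_anti : antisymmetric mm_le.
Proof.
elim/mm_ind=> f T; elim/mm_ind=> g U /andP[/mm_leP[TU c] /mm_leP[UT d]].
have e : T = U by apply/le_anti; rewrite TU UT.
by apply/mm_classP; rewrite e.
Qed.
Fact mm_le_trans : transitive mm_le.
Proof.
elim/mm_ind=> g U; elim/mm_ind=> f T; elim/mm_ind=> h S.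
move=> /mm_leP[TU c] /mm_leP[US d]; apply/mm_leP; split.
  exact: le_trans US.
by have := vt_carriesM (vt_carries_le US c) d; rewrite mulgA mulgK.
Qed.

HB.instance Definition _ := Order.Le_isPOrder.Build
  (Order.Disp tt tt) MM mm_le_refl mm_le_anti mm_le_trans.

Definition spaut_act f (c : MM) : MM :=
  mm_class (act_basis f (repr c).1) (repr c).2.
Definition out_act (o : SPOut G) (c : MM) : MM := spaut_act (repr o) c.

Fact spaut_actE f X T : spaut_act f (mm_class X T) = mm_class (act_basis f X) T.
Proof.
rewrite /spaut_act; have : mm_class (repr (mm_class X T)).1
    (repr (mm_class X T)).2 = mm_class X T.
  by rewrite -[RHS]reprK /mm_class -surjective_pairing.
case: (repr (mm_class X T)) => Y U /=.
have [g ->] := basis_std X; have [h ->] := basis_std Y.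
move=> /mm_classP[-> c]; rewrite -!act_basisM; apply/mm_classP; split=> //.
by rewrite invgM mulgA mulgVK.
Qed.

(* The action of the outer class of alpha is [X, A] |-> [alpha(X), A]. *)
Lemma out_actE f X T :
  out_act (\pi_(SPOut G) f) (mm_class X T) = mm_class (act_basis f X) T.
Proof.
rewrite /out_act spaut_actE; have [g ->] := basis_std X.
rewrite -!act_basisM; apply/mm_classP; split=> //.
have := vt_carries_inner T (is_innerJ g (repr_out f)).
by rewrite invgM !mulgA.
Qed.

End MarkedVertexTypes.

(* Imported only here: classical_sets shadows many names of finset. *)
From mathcomp Require Import classical_sets cardinality fsbigop reals freeg.

Local Open Scope classical_set_scope.

(* K is the set of (nonempty, finite) simplices, each given by its vertex set. *)
Definition order_complex (d : Order.disp_t) (P : porderType d) : set (set P) :=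
  [set s | [/\ finite_set s, s !=set0 &
            forall x y, s x -> s y -> (x >=< y)%O]].

Arguments order_complex {d} P.

Definition full_subcomplex (T : Type) (K : set (set T)) (S : set T) :
  set (set T) := [set s | K s /\ s `<=` S].

Definition subcomplex (T : Type) (L K : set (set T)) : Prop :=
  L `<=` K /\ forall s t : set T, L s -> t !=set0 -> t `<=` s -> L t.

Definition simplicial_iso (T U : Type) (K : set (set T)) (L : set (set U))
    (j : T -> U) : Prop :=
  [/\ injective j, forall s, K s -> L (j @` s) &
      forall t, L t -> exists2 s, K s & j @` s = t].

(* Points of the geometric realization, by their barycentric coordinates. *)
Definition realization (R : realType) (T : choiceType) (K : set (set T)) :
  set (T -> R) :=
  [set x | [/\ forall v, (0 <= x v)%R, K [set v | x v != 0%R] &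
            (\sum_(v \in [set: T]) x v)%R = 1%R]].
Arguments realization R {T} K.

Section Actions.
Variables (H : groupType) (T : choiceType).
Implicit Types (act : H -> T -> T) (K L : set (set T)).

Definition is_group_action act : Prop :=
  (forall v, act 1 v = v) /\ (forall g h v, act (g * h) v = act g (act h v)).

Definition simplicial_action K act : Prop :=
  is_group_action act /\ forall g s, K s -> K (act g @` s).

Definition stabilizer act (s : set T) : set H := [set g | act g @` s = s].

(* The induced affine action moves the coordinate at v to the vertex g.v. *)
Definition act_point (R : realType) act (g : H) (x : T -> R) : T -> R :=
  fun v => x (act (g^-1)%g v).

Definition fundamental_domain (R : realType) K act L : Prop :=
  subcomplex L K /\
  forall x, realization R K x ->
    exists! y, realization R L y /\ exists g, y = act_point act g x.

Definition free_abelian (S : set H) : Prop :=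
  exists (I : choiceType) (phi : {freeg I / int} -> H),
    [/\ forall x y, phi (x + y)%R = phi x * phi y, injective phi &
        range phi = S].

End Actions.

Definition wh_vertex (G : sgraph) (T : vertex_type G) : MM G :=
  mm_class (std_basis G) T.

Definition wh_subcomplex (G : sgraph) : set (set (MM G)) :=
  full_subcomplex (order_complex (MM G)) (range (@wh_vertex G)).

Arguments wh_subcomplex G : clear implicits.

(* Main.v *)
From HB Require Import structures.
Require Import Defs.
From mathcomp Require Import all_boot all_order all_algebra.
From mathcomp Require Import generic_quotient boolp ring freeg.

(** The action preserves the vertex type of a class, and two comparable
    classes with the same type are equal. So an element stabilizing a simplex
    fixes each of its vertices, and no orbit meets a simplex twice.

    Fundamental domain. If [alpha(V), A] is the least vertex of a simplex,
    every other vertex of that simplex has the form [alpha(V), B] with the same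
    alpha, so alpha^-1 carries the whole simplex into the Whitehead subcomplex
    ([wh_translate]). A group element that maps a point of this subcomplex to a
    point of it fixes each vertex supporting the point, because the vertices of
    the subcomplex are told apart by their types ([wh_point_unique]).

    Stabilizers. The stabilizer of a simplex is the stabilizer of its least
    vertex [alpha(V), A], since what A carries is carried by every B >= A.
    This is the conjugate by alpha of the group of outer classes carried by A
    ([stabilizerE]), and what remains is to see that the latter is free
    abelian.

    - It is abelian. An automorphism carried by a based partition at a is a
      twist: it conjugates each c by a power a ^ p(c), with p constant on
      petals. Subtracting a constant from p changes the twist by an inner
      automorphism only. Twists at equal or adjacent vertices commute. Given
      compatible partitions at distinct nonadjacent a and b, normalize p to
      vanish on the petal of b and q to vanish on the petal of a: because the
      partitions do not cross, the supports of p and q are then disjoint, and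
      each twist fixes the conjugator of the other one
      ([out_twist_commute]). Hence a carried class is determined by a family p
      of exponents p(a, c), additively ([out_multitwistD]).

    - The only relations are the normalizations. The centralizer of a
      generator b contains only elements with exponent sum 0 in every a outside
      the star of b; this is read off in the integral Heisenberg group, to
      which the group maps by sending a and b to the standard generators and
      the other vertices to 1 ([esum_commute_gen]). So if b is sent to b ^ g,
      the exponent sum of g in a depends on the automorphism only; for the
      multitwist of p it is p(a, b), and for conjugation by x it is the
      exponent sum of x in a, whatever b is ([multitwist_inner]).

    Therefore the twists along all petals but one at each vertex form a basis
    of the carried classes ([out_exponents_eq1], [out_exponents_surj]). *)

Set Implicit Arguments.
Unset Strict Implicit.
Unset Printing Implicit Defensive.

Import Order.TTheory GRing.Theory.

Local Open Scope group_scope.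
Local Open Scope quotient_scope.

(** * The universal property of a right-angled Artin group *)

Section GroupMorphisms.
Variables (G : sgraph) (H : groupType).

Lemma morph1g (f : raag G -> H) : {morph f : x y / x * y} -> f 1 = 1.
Proof. by move=> fM; apply: (mulgI (f 1)); rewrite -fM !mulg1. Qed.

Lemma morphVg (f : raag G -> H) x :
  {morph f : x y / x * y} -> f x^-1 = (f x)^-1.
Proof.
by move=> fM; apply: (mulgI (f x)); rewrite -fM !mulgV (morph1g fM).
Qed.

Lemma morph_gen_ext (f g : raag G -> H) :
    {morph f : x y / x * y} -> {morph g : x y / x * y} ->
  (forall v, f (gen v) = g (gen v)) -> f =1 g.
Proof.
move=> fM gM fg; elim/gen_ind => [|v x IH|v x IH].
- by rewrite !morph1g.
- by rewrite fM gM fg IH.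
- by rewrite fM gM !morphVg // fg IH.
Qed.

Variable phi : G -> H.

Definition eval_letter (x : letter G) : H :=
  if x.2 then phi x.1 else (phi x.1)^-1.
Definition eval_word (w : word G) : H := \prod_(x <- w) eval_letter x.
Definition raag_lift (x : raag G) : H := eval_word (repr x).

Hypothesis phiC : forall a b, adj a b -> commute (phi a) (phi b).

Lemma eval_word_raag_eq u v : raag_eq u v -> eval_word u = eval_word v.
Proof.
elim=> {u v} [u|u v _ ->|u v w _ -> _ ->|u w [a b]|u w a b /phiC ab] //.
  rewrite /eval_word !big_cat !big_cons /= [eval_letter _ * (_ * _)]mulgA.
  by case: b; rewrite /eval_letter /= ?mulgV ?mulVg mul1g.
rewrite /eval_word !big_cat !big_cons /= !mulgA.
by rewrite -[_ * phi a * _]mulgA ab mulgA.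
Qed.

Lemma raag_lift_pi w : raag_lift (\pi_(raag G) w) = eval_word w.
Proof. exact: eval_word_raag_eq (repr_raag w). Qed.

Lemma raag_liftM : {morph raag_lift : x y / x * y}.
Proof.
elim/quotW=> u; elim/quotW=> v; rewrite [_ * _]raag_mulE !raag_lift_pi.
exact: big_cat.
Qed.

Lemma raag_lift_gen v : raag_lift (gen v) = phi v.
Proof. by rewrite raag_lift_pi /eval_word big_seq1. Qed.

End GroupMorphisms.

(** * Exponent sums of conjugators *)

(** The integral Heisenberg group: (x, y, z) stands for the unipotent upper
    triangular matrix with x, y next to the diagonal and z in the corner. An
    element commuting with (0, 1, 0) has first coordinate 0, which could not be
    seen in the abelianization. *)
Definition heis : Type := (int * int * int)%type.
HB.instance Definition _ := Choice.on heis.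

Section Heisenberg.
Local Open Scope ring_scope.

Definition heis_mul (x y : heis) : heis :=
  (x.1.1 + y.1.1, x.1.2 + y.1.2, x.2 + y.2 + x.1.1 * y.1.2).
Definition heis_one : heis := (0, 0, 0).
Definition heis_inv (x : heis) : heis :=
  (- x.1.1, - x.1.2, - x.2 + x.1.1 * x.1.2).

Lemma heis_mulA : associative heis_mul.
Proof.
case=> [[a b] c] [[d e] f] [[g h] i].
by rewrite /heis_mul /=; do 2?congr pair; ring.
Qed.
Lemma heis_mul1 : left_id heis_one heis_mul.
Proof. by case=> [[a b] c]; rewrite /heis_mul /=; do 2?congr pair; ring. Qed.
Lemma heis_1mul : right_id heis_one heis_mul.
Proof. by case=> [[a b] c]; rewrite /heis_mul /=; do 2?congr pair; ring. Qed.
Lemma heis_mulV : left_inverse heis_one heis_inv heis_mul.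
Proof.
by case=> [[a b] c]; rewrite /heis_mul /heis_one /=; do 2?congr pair; ring.
Qed.
Lemma heis_Vmul : right_inverse heis_one heis_inv heis_mul.
Proof.
by case=> [[a b] c]; rewrite /heis_mul /heis_one /=; do 2?congr pair; ring.
Qed.

End Heisenberg.

HB.instance Definition _ :=
  isGroup.Build heis heis_mulA heis_mul1 heis_1mul heis_mulV heis_Vmul.

Lemma heis_mulE (x y : heis) : x * y = heis_mul x y. Proof. by []. Qed.

Section ExponentSum.
Variable G : sgraph.
Implicit Types (a b v : G) (x y : raag G).

Definition heis_gen a b v : heis := (Posz (v == a), Posz (v == b), Posz 0).

(** No two adjacent vertices map to two distinct standard generators, as a and
    b are not adjacent. *)
Lemma heis_genC a b : ~~ adj a b ->
  forall u v, adj u v -> commute (heis_gen a b u) (heis_gen a b v).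
Proof.
move=> nab u v uv.
have z s t : adj s t -> (Posz (s == a) * Posz (t == b) = 0)%R.
  move=> st; case: eqP => [sa|_]; last by rewrite mul0r.
  case: eqP => [tb|_]; last by rewrite mulr0.
  by rewrite -sa -tb st in nab.
rewrite /commute !heis_mulE /heis_mul /= !z //; last by rewrite adj_sym.
by congr (_, _, _); rewrite addrC.
Qed.

(** Taking b := a in [heis_gen] makes the definition depend on a alone; by
    [heis_lift1] any b not adjacent to a gives the same first coordinate. *)
Definition esum a x : int := (raag_lift (heis_gen a a) x).1.1.

Lemma esumM a x y : esum a (x * y) = (esum a x + esum a y)%R.
Proof. by rewrite /esum raag_liftM //; apply: heis_genC; rewrite adj_irr. Qed.

Lemma esum_gen a v : esum a (gen v) = Posz (v == a).
Proof.
by rewrite /esum raag_lift_gen //; apply: heis_genC; rewrite adj_irr.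
Qed.

Lemma esum1 a : esum a 1 = 0%R.
Proof. by apply: (addrI (esum a 1)); rewrite -esumM mulg1 addr0. Qed.

Lemma esumV a x : esum a x^-1 = (- esum a x)%R.
Proof. by apply: (addrI (esum a x)); rewrite -esumM mulgV esum1 subrr. Qed.

Lemma esumJ a x y : esum a (x ^ y) = esum a x.
Proof. by rewrite conjgE !esumM esumV; ring. Qed.

Lemma heis_lift1 a b x :
  ~~ adj a b -> (raag_lift (heis_gen a b) x).1.1 = esum a x.
Proof.
move=> /heis_genC hC; elim/gen_ind: x => [|v x IH|v x IH].
- by rewrite esum1 (morph1g (raag_liftM hC)).
- by rewrite esumM raag_liftM // raag_lift_gen // esum_gen -IH.
- rewrite esumM raag_liftM // (morphVg _ (raag_liftM hC)) raag_lift_gen //.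
  by rewrite esumV esum_gen -IH.
Qed.

(** In the Heisenberg group, the corner entries of (x, y, z) * (0, 1, 0) and
    (0, 1, 0) * (x, y, z) differ by x. *)
Lemma esum_commute_gen a b x :
  b \notin st a -> commute x (gen b) -> esum a x = 0%R.
Proof.
rewrite !inE negb_or => /andP[ba nab] xb; rewrite -(heis_lift1 x nab).
have hC := heis_genC nab.
have := congr1 (fun y => (raag_lift (heis_gen a b) y).2) xb.
rewrite !raag_liftM // raag_lift_gen // !heis_mulE /= eqxx (negPf ba).
rewrite mul0r mulr1 addr0 add0r addr0 => /(canRL (addKr _)).
by rewrite addrC subrr.
Qed.

(** Makes the exponent sum in a of the conjugator of b an invariant of the
    automorphism, although the conjugator itself is only defined up to the
    centralizer of b. *)
Lemma esum_conjugator a b x y :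
  b \notin st a -> gen b ^ x = gen b ^ y -> esum a x = esum a y.
Proof.
move=> ba xy; have : commute (x * y^-1) (gen b).
  by rewrite /commute [RHS]conjgC conjgM xy conjgK.
move/(esum_commute_gen ba); rewrite esumM esumV => /eqP.
by rewrite subr_eq0 => /eqP.
Qed.

Lemma esum_zexpg a v n : esum a (zexpg (gen v) n) = (n *+ (v == a))%R.
Proof.
have eX k : esum a (gen v ^+ k) = (Posz k *+ (v == a))%R.
  elim: k => [|k IH]; first by rewrite expg0 esum1 mul0rn.
  by rewrite expgS esumM IH esum_gen intS; case: (v == a).
by case: n => n; rewrite /zexpg ?esumV eX // NegzE mulNrn.
Qed.

(** Conjugating generators does not change their images in the abelianization,
    so conjugator exponents add up under composition. *)
Lemma esum_spaut a (f : SPAut G) x : esum a (f x) = esum a x.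
Proof.
have /asboolP fP := spautP f.
elim/gen_ind: x => [|v x IH|v x IH]; first by rewrite aut1.
  by rewrite aut_morph !esumM IH; have [g ->] := fP v; rewrite esumJ.
rewrite aut_morph autV !esumM !esumV IH.
by have [g ->] := fP v; rewrite esumJ.
Qed.

End ExponentSum.

(** * Twists *)

Section IntegerPowers.
Variable H : groupType.
Implicit Types (x : H) (m n : int).

Lemma zexpgS x n : zexpg x (1 + n)%R = x * zexpg x n.
Proof.
case: n => [k|[|k]].
- exact: expgS.
- by rewrite /= mulgV.
- have -> : (1 + Negz k.+1)%R = Negz k.
    by rewrite !NegzE [in LHS]intS opprD addrA subrr add0r.
  by rewrite /zexpg [in RHS]expgSr invgM mulVKg.
Qed.

Lemma zexpgD x m n : zexpg x (m + n)%R = zexpg x m * zexpg x n.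
Proof.
elim: m => [|m IH|m IH]; first by rewrite add0r mul1g.
  by rewrite intS -addrA !zexpgS IH mulgA.
apply: (mulgI x); rewrite mulgA -!zexpgS addrA.
by rewrite (_ : (1 - _)%R = - Posz m)%R // intS; ring.
Qed.

Lemma commute_zexpg x y n : commute x y -> commute x (zexpg y n).
Proof.
by case: n => n xy; rewrite /zexpg; [|apply: commuteV]; apply: commuteX.
Qed.

End IntegerPowers.

Lemma morph_zexpg (G : sgraph) (H : groupType) (f : raag G -> H) x n :
  {morph f : x y / x * y} -> f (zexpg x n) = zexpg (f x) n.
Proof.
move=> fM; have fX k : f (x ^+ k) = f x ^+ k.
  by elim: k => [|k IH]; rewrite ?expg0 ?(morph1g fM) // !expgS fM IH.
by case: n => n; rewrite /= ?(morphVg _ fM) fX.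
Qed.

Section Twists.
Variable G : sgraph.
Implicit Types (a b c d : G) (p q : G -> int) (A B : {set {set G}}).
Implicit Types (f g : SPAut G).

Lemma st_refl a : a \in st a. Proof. by rewrite !inE eqxx. Qed.

Lemma st_sym a b : (a \in st b) = (b \in st a).
Proof. by rewrite !inE eq_sym adj_sym. Qed.

Lemma conj_st a c n : c \in st a -> gen c ^ zexpg (gen a) n = gen c.
Proof.
move=> ca; suff : commute (gen c) (zexpg (gen a) n).
  by rewrite conjgE => ->; rewrite mulKg.
apply: commute_zexpg; move: ca; rewrite !inE => /orP[/eqP-> //|ac].
exact/esym/gen_adj.
Qed.

Definition component_const a p : Prop :=
  forall c d, c \notin st a -> d \notin st a -> adj c d -> p c = p d.

(** Two adjacent vertices are conjugated by the same power of a: this is clear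
    off the star of a, and a vertex of the star may be thought of as conjugated
    by any power of a, which fixes it. Hence the relations are respected; the
    opposite exponents give the inverse. *)
Lemma twist_subproof a p : component_const a p ->
  exists f, forall c, f (gen c) = gen c ^ zexpg (gen a) (p c).
Proof.
pose phi q c := gen c ^ zexpg (gen a) (q c).
have phiC q : component_const a q ->
    forall c d, adj c d -> commute (phi q c) (phi q d).
  move=> qc c d cd.
  suff [n [-> ->]] : exists n, phi q c = gen c ^ zexpg (gen a) n /\
                               phi q d = gen d ^ zexpg (gen a) n.
    by rewrite /commute -!conjMg (gen_adj cd).
  case: (boolP (c \in st a)) => [ca|nca].
    by exists (q d); rewrite /phi !(conj_st _ ca).
  case: (boolP (d \in st a)) => [da|nda].
    by exists (q c); rewrite /phi !(conj_st _ da).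
  by exists (q c); rewrite /phi (qc c d).
have phiK q r : component_const a q -> component_const a r ->
    (forall c, (q c + r c = 0)%R) ->
    cancel (raag_lift (phi r)) (raag_lift (phi q)).
  move=> /phiC qC /phiC rC qr.
  have qM := raag_liftM qC; have rM := raag_liftM rC.
  apply: (morph_gen_ext (g := id)) => // [x y|c]; first by rewrite rM qM.
  rewrite raag_lift_gen //= /phi conjgE !qM (morphVg _ qM) -conjgE.
  rewrite morph_zexpg // !raag_lift_gen // /phi (conj_st _ (st_refl a)).
  rewrite -conjgM -zexpgD qr.
  exact: conjg1.
move=> pc; pose r c := (- p c)%R.
have rc : component_const a r by move=> c d *; rewrite /r (pc c d).
have pK : cancel (raag_lift (phi r)) (raag_lift (phi p)).
  by apply: phiK => // c; rewrite subrr.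
have rK : cancel (raag_lift (phi p)) (raag_lift (phi r)).
  by apply: phiK => // c; rewrite addNr.
have gE c := raag_lift_gen (phiC p pc) c.
have fP : pure_symmetric (Aut (raag_liftM (phiC p pc)) (Bijective rK pK)).
  by apply/asboolP => v; exists (zexpg (gen a) (p v)); apply: gE.
by exists (MkSPAut fP).
Qed.

(** The default 1 is reached only when p is not constant on the components of
    the complement of the star. *)
Definition twist a p : SPAut G :=
  if pselect (exists f, forall c, f (gen c) = gen c ^ zexpg (gen a) (p c))
  is left e then projT1 (cid e) else 1.

Section TwistTheory.
Variable a : G.

Lemma twistE p c : component_const a p ->
  twist a p (gen c) = gen c ^ zexpg (gen a) (p c).
Proof.
move=> /twist_subproof e; rewrite /twist; case: pselect => // e'.
by case: cid.
Qed.

Lemma twist_ext f p : component_const a p ->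
  (forall c, f (gen c) = gen c ^ zexpg (gen a) (p c)) -> f = twist a p.
Proof. by move=> pc fE; apply: spaut_gen => c; rewrite fE twistE. Qed.

Lemma twist_zexpg p b n : component_const a p ->
  gen b ^ zexpg (gen a) (p b) = gen b ->
  twist a p (zexpg (gen b) n) = zexpg (gen b) n.
Proof.
move=> pc pb; rewrite morph_zexpg ?twistE ?pb //.
exact: aut_morph.
Qed.

Lemma component_constD p q : component_const a p -> component_const a q ->
  component_const a (fun c => p c + q c)%R.
Proof. by move=> pc qc c d *; rewrite (pc c d) ?(qc c d). Qed.

Lemma twistD p q : component_const a p -> component_const a q ->
  twist a (fun c => p c + q c)%R = twist a p * twist a q.
Proof.
move=> pc qc; apply/esym/twist_ext => [|c]; first exact: component_constD.
rewrite spautME twistE // autJ twistE //.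
rewrite twist_zexpg ?(conj_st _ (st_refl a)) //.
by rewrite -conjgM zexpgD.
Qed.

Lemma twist_cst_inner n : is_inner (twist a (fun=> n)).
Proof.
exists (zexpg (gen a) n).
apply: (morph_gen_ext (g := fun x => x ^ _)) => [x y|x y|c].
- exact: aut_morph.
- exact: conjMg.
- by rewrite twistE.
Qed.

End TwistTheory.

Lemma out_piM f g : \pi_(SPOut G) (f * g) = \pi_(SPOut G) f * \pi_(SPOut G) g.
Proof. by rewrite -out_mulE. Qed.

Lemma out_piV f : \pi_(SPOut G) f^-1 = (\pi_(SPOut G) f)^-1.
Proof. by rewrite -out_invE. Qed.

Lemma out_pi_inner f : is_inner f -> \pi_(SPOut G) f = 1.
Proof. by move=> fi; apply/esym/out_piP; rewrite invg1 mul1g. Qed.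

(** The twist by a constant n is conjugation by a ^ n, hence trivial as an
    outer class. *)
Lemma out_twistB a p n : component_const a p ->
  \pi_(SPOut G) (twist a (fun c => p c - n)%R) = \pi_(SPOut G) (twist a p).
Proof.
move=> pc; rewrite (twistD pc) // out_piM.
by rewrite (out_pi_inner (twist_cst_inner _ _)) mulg1.
Qed.

(** Twists commute if each fixes the conjugator of the other and no generator is
    moved by both. *)
Lemma commute_twist a b p q :
    component_const a p -> component_const b q ->
    gen b ^ zexpg (gen a) (p b) = gen b ->
    gen a ^ zexpg (gen b) (q a) = gen a ->
    (forall c, gen c ^ zexpg (gen a) (p c) = gen c \/
               gen c ^ zexpg (gen b) (q c) = gen c) ->
  commute (twist a p) (twist b q).
Proof.
move=> pc qc pb qa pq; apply: spaut_gen => c.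
rewrite !spautME (twistE _ pc) (twistE _ qc).
case: (pq c) => e; rewrite e autJ twist_zexpg //.
  by rewrite (twistE _ pc) (twistE _ qc) e.
by rewrite (twistE _ pc) (twistE _ qc) e.
Qed.

Lemma commute_twist_adj a b p q :
    component_const a p -> component_const b q -> a \in st b ->
  commute (twist a p) (twist b q).
Proof.
move=> pc qc; rewrite !inE => /orP[/eqP ab|ab].
  subst b; rewrite /commute -!twistD //.
  by congr twist; apply/funext => c; rewrite addrC.
have ast : a \in st b by rewrite !inE ab orbT.
have bst : b \in st a by rewrite st_sym.
apply: spaut_gen => c.
rewrite !spautME (twistE _ pc) (twistE _ qc) !autJ !twist_zexpg ?conj_st //.
rewrite (twistE _ pc) (twistE _ qc) -!conjgM; congr (_ ^ _).
exact/commute_zexpg/commute_sym/commute_zexpg/gen_adj.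
Qed.

Definition petal_const a A p : Prop :=
  forall P b c, P \in petals a A -> b \in P -> c \in P -> p b = p c.

Lemma petal_of a A c : based_partition a A -> c \notin st a ->
  pblock A c \in petals a A /\ c \in pblock A c.
Proof.
move=> /and3P[pA _ _]; rewrite !inE negb_or => /andP[ca nac].
have cA : c \in cover A by rewrite (cover_partition pA) !inE.
have cP : c \in pblock A c by rewrite mem_pblock.
split=> //; apply/andP; split; last exact: pblock_mem.
by apply: contraNneq ca => e; rewrite e inE in cP.
Qed.

(** Petals are unions of components of the complement of the star. *)
Lemma petal_component_const a A p :
  based_partition a A -> petal_const a A p -> component_const a p.
Proof.
move=> bA pc c d ca da cd; have [PA cP] := petal_of bA ca.
apply: pc (PA) cP _; have /and3P[_ _ /forall_inP/(_ _ PA)] := bA.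
case/existsP=> C /andP[/subsetP CA /eqP PC].
have : c \in cover C by rewrite -PC; case: (petal_of bA ca).
rewrite PC => /bigcupP[K KC cK]; apply/bigcupP; exists K => //.
have eqR : {in ~: st a & &, equivalence_rel (connect (adj_off_st a))}.
  apply: in3W; apply/equivalence_relP; split=> [x|x y xy z].
    exact: connect0.
  have sC : connect_sym (adj_off_st a).
    by apply: sym_connect_sym => u v; rewrite /adj_off_st /= adj_sym andbCA.
  exact: (same_connect sC).
have cst : c \in ~: st a by rewrite in_setC.
have dst : d \in ~: st a by rewrite in_setC.
have /and3P[_ tK _] := equivalence_partitionP eqR.
rewrite -(def_pblock tK (CA _ KC) cK) pblock_equivalence_partition //.
by apply: connect1; apply/and3P.
Qed.

Lemma bp_carries_twist a A p : based_partition a A -> petal_const a A p ->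
  bp_carries a A (twist a p).
Proof.
move=> bA pA; have pc := petal_component_const bA pA.
by exists p; split=> [b ba|b _|//]; rewrite twistE // conj_st.
Qed.

Lemma bp_carriesP a A f : based_partition a A -> bp_carries a A f ->
  exists2 p, petal_const a A p & f = twist a p.
Proof.
move=> bA [p [fst fnst pA]]; exists p => //.
apply: twist_ext; first exact: petal_component_const pA.
move=> c; case: (boolP (c \in st a)) => ca; last exact: fnst.
by rewrite fst // conj_st.
Qed.

(** This is where noncrossing enters. Up to inner automorphisms the exponents
    may be normalized to vanish on the petal of the other operative vertex; then
    a vertex moved by both twists would lie in a petal of A without b and in a
    petal of B without a, that is, the partitions would cross. *)
Lemma out_twist_commute a b A B p q :
    based_partition a A -> based_partition b B -> compatible a A b B ->
    petal_const a A p -> petal_const b B q ->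
  commute (\pi_(SPOut G) (twist a p)) (\pi_(SPOut G) (twist b q)).
Proof.
move=> bA bB AB pA qB.
have pc := petal_component_const bA pA; have qc := petal_component_const bB qB.
case: (boolP (a \in st b)) AB => [ab _|ab].
  by rewrite /commute -!out_piM; congr \pi; apply: commute_twist_adj.
rewrite /compatible (negPf ab) /cross ab => /negP nX.
(* Now p vanishes on the petal of b and q on the petal of a. *)
rewrite -(out_twistB (p b) pc) -(out_twistB (q a) qc).
rewrite /commute -!out_piM; congr \pi.
apply: commute_twist; rewrite ?subrr ?conjg1 //.
- exact: component_constD.
- exact: component_constD.
move=> c; case: (boolP (c \in st a)) => ca; first by left; rewrite conj_st.
case: (boolP (c \in st b)) => cb; first by right; rewrite conj_st.
have [PA cP] := petal_of bA ca; have [QB cQ] := petal_of bB cb.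
case: (boolP (b \in pblock A c)) => [bP|nbP].
  by left; rewrite (pA _ _ _ PA cP bP) subrr conjg1.
case: (boolP (a \in pblock B c)) => [aQ|naQ].
  by right; rewrite (qB _ _ _ QB cQ aQ) subrr conjg1.
case: nX; apply/exists_inP; exists (pblock A c) => //.
apply/exists_inP; exists (pblock B c); rewrite // naQ nbP.
by apply/set0Pn; exists c; rewrite inE cP.
Qed.

End Twists.

(** * Multitwists *)

Lemma prod_commuteM (H : groupType) (I : Type) (r : seq I) (F E : I -> H) :
    (forall i j, commute (F i) (E j)) ->
  \prod_(i <- r) (F i * E i) = (\prod_(i <- r) F i) * \prod_(i <- r) E i.
Proof.
move=> FE; elim: r => [|i r IH]; rewrite ?big_nil ?mulg1 // !big_cons IH.
rewrite -!mulgA; congr (_ * _); rewrite !mulgA; congr (_ * _).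
by apply: commute_prod => j _; apply/commute_sym/FE.
Qed.

Section Multitwists.
Variables (G : sgraph) (T : vertex_type G).
Implicit Types (a b c : G) (p q : G -> G -> int).

Definition adapted p : Prop := forall a, petal_const a (T a) (p a).

(** The factors need not commute: another order gives another automorphism, but
    the same outer class when p is adapted. *)
Definition multitwist p : SPAut G := \prod_(a : G) twist a (p a).

Lemma vt_compatible a b : compatible a (T a) b (T b).
Proof. by case: T => U /= /andP[_ /forallP/(_ a)/forallP/(_ b)]. Qed.

Lemma adapted_component p a : adapted p -> component_const a (p a).
Proof. by move/(_ a); apply: petal_component_const (vt_based T a). Qed.

Lemma out_multitwistE p : \pi_(SPOut G) (multitwist p) =
  \prod_(a : G) \pi_(SPOut G) (twist a (p a)).
Proof. exact: (big_morph _ (@out_piM G) (erefl _)). Qed.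

Lemma out_multitwistD p q : adapted p -> adapted q ->
  \pi_(SPOut G) (multitwist (fun a c => p a c + q a c)%R) =
  \pi_(SPOut G) (multitwist p) * \pi_(SPOut G) (multitwist q).
Proof.
move=> pT qT; rewrite !out_multitwistE -prod_commuteM.
  apply: eq_bigr => a _; rewrite twistD ?out_piM //; exact: adapted_component.
move=> a b; apply: out_twist_commute (pT a) (qT b); first exact: vt_based.
  exact: vt_based.
exact: vt_compatible.
Qed.

Lemma out_multitwistB p (n : G -> int) : adapted p ->
  \pi_(SPOut G) (multitwist (fun a c => p a c - n a)%R) =
  \pi_(SPOut G) (multitwist p).
Proof.
move=> pT; rewrite !out_multitwistE; apply: eq_bigr => a _.
exact/out_twistB/adapted_component.
Qed.

Lemma vt_carries_multitwist p : adapted p -> vt_carries T (multitwist p).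
Proof.
move=> pT; apply: (big_ind (vt_carries T)) => [|f g|a _].
- exact: vt_carries1.
- exact: vt_carriesM.
- exact/(@vt_carries_bp _ _ _ a)/bp_carries_twist/pT/vt_based.
Qed.

Lemma vt_carries_out_multitwist f : vt_carries T f ->
  exists2 p, adapted p & \pi_(SPOut G) f = \pi_(SPOut G) (multitwist p).
Proof.
case=> s sT ->; elim: s sT => [|g s IH] sT.
  exists (fun _ _ => 0%R); first by [].
  rewrite big_nil out_multitwistE; apply/esym/big1 => a _.
  exact/out_pi_inner/twist_cst_inner.
have [|p pT sE] := IH; first by move=> h hs; apply: sT; rewrite inE hs orbT.
have [|a] := sT g; first by rewrite inE eqxx.
case/(bp_carriesP (vt_based T a)) => q qT gE.
pose r b c := if b == a then q c else 0%R.
have rT : adapted r.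
  by move=> b P c d; rewrite /r; case: eqP => // ->; apply: qT.
exists (fun b c => r b c + p b c)%R.
  by move=> b P c d PT cP dP; rewrite (rT b P c d) ?(pT b P c d).
rewrite big_cons out_piM sE out_multitwistD //; congr (_ * _).
rewrite out_multitwistE (big_only1 a) //= => [|b ba _].
  by rewrite gE /r eqxx.
by rewrite /r (negPf ba); apply/out_pi_inner/twist_cst_inner.
Qed.

(** Conjugators compose as g * f(h), and f preserves the exponent sums of h; so
    each factor of the multitwist contributes its own exponent. *)
Lemma multitwist_conjugator p b : adapted p ->
  exists2 g, multitwist p (gen b) = gen b ^ g & forall a, esum a g = p a b.
Proof.
move=> pT; suff ind (s : seq G) : uniq s ->
    exists2 g, (\prod_(a <- s) twist a (p a)) (gen b) = gen b ^ g &
      forall a, esum a g = (p a b *+ (a \in s))%R.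
  have [g gE ge] := ind _ (index_enum_uniq G); exists g => // a.
  by rewrite ge mem_index_enum.
elim: s => [|c s IH] /=.
  by exists 1 => [|a]; rewrite ?esum1 // big_nil conjg1.
case/andP=> cs /IH[g gE ge]; exists (zexpg (gen c) (p c b) * twist c (p c) g).
  rewrite big_cons spautME gE autJ twistE ?conjgM //.
  exact: adapted_component.
move=> a; rewrite esumM esum_spaut esum_zexpg ge inE eq_sym.
case: (eqVneq a c) => [->|_] /=; last by rewrite mulr0n add0r.
by rewrite (negPf cs) mulr0n addr0.
Qed.

(** If the multitwist is conjugation by x, both b and c are conjugated by x, and
    both exponents are the exponent sum of x in a. *)
Lemma multitwist_inner p a b c : adapted p -> is_inner (multitwist p) ->
  b \notin st a -> c \notin st a -> p a b = p a c.
Proof.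
move=> pT [x xE]; suff e d : d \notin st a -> p a d = esum a x.
  by move=> /e-> /e->.
move=> da; have [g gE ge] := multitwist_conjugator d pT.
by rewrite -ge; apply: esum_conjugator da _; rewrite -gE xE.
Qed.

End Multitwists.

(** * A free basis of the outer classes carried by a vertex type *)

Lemma eq_twist (G : sgraph) (a : G) (p q : G -> int) :
    component_const a p -> component_const a q ->
    (forall c, c \notin st a -> p c = q c) ->
  twist a p = twist a q.
Proof.
move=> pc qc pq; apply: twist_ext => // c; rewrite twistE //.
by case: (boolP (c \in st a)) => ca; [rewrite !conj_st | rewrite pq].
Qed.

Section FreeBasis.
Variables (G : sgraph) (T : vertex_type G).
Implicit Types (a b c : G) (P : {set G}) (p : G -> G -> int).

Lemma petal_nonempty a P : P \in petals a (T a) -> P != set0.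
Proof.
case/setD1P=> _; have /and3P[/and3P[_ _ nA] _ _] := vt_based T a.
by apply: contraTneq => ->.
Qed.

Lemma petal_off_st a P c : P \in petals a (T a) -> c \in P -> c \notin st a.
Proof.
case/setD1P=> Pa PA cP; have /and3P[pA aA _] := vt_based T a.
have nac : c \notin lk a.
  rewrite -in_setC -(cover_partition pA).
  by apply/bigcupP; exists P.
rewrite !inE negb_or; rewrite inE in nac; rewrite nac andbT.
have /and3P[_ tA _] := pA.
have := trivIsetP tA _ _ PA aA Pa; rewrite -setI_eq0.
apply: contraTneq => ca; apply/set0Pn; exists a.
by rewrite !inE eqxx -ca cP.
Qed.

Lemma petal_pblock a P c :
  P \in petals a (T a) -> c \in P -> pblock (T a) c = P.
Proof.
case/setD1P=> _ PA cP; have /and3P[/and3P[_ tA _] _ _] := vt_based T a.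
exact: def_pblock.
Qed.

(** The petal on which exponents are normalized to 0. If the star of a is the
    whole graph there is no petal, the value is set0, and a contributes nothing
    to the basis. *)
Definition base_petal a : {set G} := odflt set0 [pick P in petals a (T a)].

Definition free_petal : pred (G * {set G}) :=
  fun i => (i.2 \in petals i.1 (T i.1)) && (i.2 != base_petal i.1).

Definition free_index : finType := {i | free_petal i}.

Implicit Types (x y : {freeg free_index / int}) (i : free_index).

Definition exponents x a c : int :=
  if insub (a, pblock (T a) c) is Some i then coeff (i : free_index) x else 0%R.

Lemma exponents_adapted x : adapted T (exponents x).
Proof.
by move=> a P b c PT bP cP; rewrite /exponents !(petal_pblock PT).
Qed.

Lemma exponentsD x y :
  exponents (x + y)%R = fun a c => (exponents x a c + exponents y a c)%R.
Proof.
apply/funext => a; apply/funext => c; rewrite /exponents.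
by case: insubP => [i _ _|_]; rewrite ?coeffD ?addr0.
Qed.

Definition out_exponents x : SPOut G :=
  \pi_(SPOut G) (multitwist (exponents x)).

Lemma out_exponentsD x y :
  out_exponents (x + y)%R = out_exponents x * out_exponents y.
Proof.
rewrite /out_exponents exponentsD.
by apply: (@out_multitwistD _ T); apply: exponents_adapted.
Qed.

(** Exponents of an inner multitwist do not depend on the petal, and they vanish
    on the base petal. *)
Lemma out_exponents_eq1 x : out_exponents x = 1 -> x = 0%R.
Proof.
move=> x1; have inn : is_inner (multitwist (exponents x)).
  by rewrite -[multitwist _]mul1g -invg1; apply/out_piP/esym.
apply/eqP/freeg_eqP => i; rewrite coeff0.
case: i => [[a P] aP]; have /andP[/= PT Pb] := aP.
have /set0Pn[b bP] := petal_nonempty PT.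
have BT : base_petal a \in petals a (T a).
  by rewrite /base_petal; case: pickP => [//|/(_ P)]; rewrite PT.
have /set0Pn[c cB] := petal_nonempty BT.
have := multitwist_inner (exponents_adapted x) inn
  (petal_off_st PT bP) (petal_off_st BT cB).
rewrite /exponents (petal_pblock PT bP) (petal_pblock BT cB).
rewrite [insub (a, base_petal a)]insubN /free_petal /= ?eqxx ?andbF //.
by rewrite (insubT (@free_petal) aP).
Qed.

Definition petal_value p a P : int :=
  if [pick b in P] is Some b then p a b else 0%R.

Lemma petal_valueE p a P c : adapted T p -> P \in petals a (T a) -> c \in P ->
  petal_value p a P = p a c.
Proof.
move=> pT PT cP; rewrite /petal_value; case: pickP => [b bP|/(_ c)].
  exact: pT PT bP cP.
by rewrite cP.
Qed.

(** Subtracting the exponent of the base petal at each vertex does not change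
    the outer class. *)
Lemma out_exponents_surj p : adapted T p ->
  exists x, \pi_(SPOut G) (multitwist p) = out_exponents x.
Proof.
move=> pT; pose q a c := (p a c - petal_value p a (base_petal a))%R.
have qT : adapted T q by move=> a P b c PT bP cP; rewrite /q (pT a P b c).
pose x := (\sum_(i : free_index)
  << petal_value q (val i).1 (val i).2 *g i >>)%R : {freeg free_index / int}.
have xE i : coeff i x = petal_value q (val i).1 (val i).2.
  rewrite raddf_sum (bigD1 i) //= big1 => [|j ji]; rewrite coeffU.
    by rewrite eqxx mulr1 addr0.
  by rewrite (negPf ji) mulr0.
exists x.
rewrite -(out_multitwistB (fun a => petal_value p a (base_petal a)) pT).
congr \pi; apply: eq_bigr => a _; apply: eq_twist.
- exact: (adapted_component qT).
- exact: (adapted_component (exponents_adapted x)).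
move=> c ca; have [PT cP] := petal_of (vt_based T a) ca.
rewrite /exponents; case: insubP => [i _ iE|].
  by rewrite xE iE (petal_valueE qT PT cP).
rewrite /free_petal /= PT negbK /= => /eqP e.
by rewrite -e (petal_valueE pT PT cP) subrr.
Qed.

End FreeBasis.

From mathcomp Require Import classical_sets cardinality fsbigop reals.

Local Open Scope classical_set_scope.

(** * Carried classes form free abelian groups *)

(** The marking f transports the basis of the classes carried by T, by
    conjugation, to the classes carried by the marked vertex type [f(V), T]. *)
Lemma free_abelian_carried (G : sgraph) (T : vertex_type G) (f : SPAut G) :
  free_abelian [set o | exists2 k, vt_carries T (f^-1 * k * f) &
                                   o = \pi_(SPOut G) k].
Proof.
pose o := \pi_(SPOut G) f.
exists (free_index T), (fun x => o * out_exponents x * o^-1); split.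
- by move=> x y; rewrite out_exponentsD !mulgA mulgVK.
- move=> x y /mulIg/mulgI xy; apply/eqP; rewrite -subr_eq0; apply/eqP.
  apply: out_exponents_eq1; apply: (mulIg (out_exponents y)).
  by rewrite -out_exponentsD subrK mul1g.
- apply/seteqP; split=> [_ [x _ <-]|_ [k kT ->]].
    have eT := exponents_adapted x.
    exists (f * multitwist (exponents x) * f^-1).
      by rewrite !mulgA mulVg mul1g mulgVK; apply: vt_carries_multitwist.
    by rewrite !out_piM out_piV.
  have [p pT kE] := vt_carries_out_multitwist kT.
  have [x xE] := out_exponents_surj pT.
  exists x => //; rewrite -xE -kE !out_piM out_piV -/o.
  by rewrite !mulgA mulgV mul1g mulgK.
Qed.

(** * The action on the complex *)

Section Action.
Variable G : sgraph.
Implicit Types (f g k : SPAut G) (o : SPOut G) (T U : vertex_type G).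
Implicit Types (c d : MM G) (s : set (MM G)).

Lemma out_act_class f g T :
  out_act (\pi_(SPOut G) f) (mm_class (act_basis g (std_basis G)) T) =
  mm_class (act_basis (f * g) (std_basis G)) T.
Proof. by rewrite out_actE act_basisM. Qed.

Lemma out_act_group : is_group_action (@out_act G).
Proof.
split=> [c|].
  by elim/mm_ind: c => g T; rewrite [1]/(out_one G) out_act_class mul1g.
elim/quotW=> f; elim/quotW=> g c; elim/mm_ind: c => h T.
by rewrite -[_ * _]out_piM !out_act_class mulgA.
Qed.

Lemma out_act1 c : out_act 1 c = c.
Proof. by case: out_act_group. Qed.

Lemma out_actM o1 o2 c : out_act (o1 * o2) c = out_act o1 (out_act o2 c).
Proof. by case: out_act_group => _; apply. Qed.

Lemma out_actK o : cancel (out_act o) (out_act o^-1).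
Proof. by move=> c; rewrite -out_actM mulVg out_act1. Qed.

Lemma out_actKV o : cancel (out_act o^-1) (out_act o).
Proof. by move=> c; rewrite -out_actM mulgV out_act1. Qed.

Lemma out_act_le o c d : (c <= d)%O -> (out_act o c <= out_act o d)%O.
Proof.
elim/quotW: o => k; elim/mm_ind: c => f T; elim/mm_ind: d => g U.
move=> /mm_leP[TU fg]; rewrite !out_act_class; apply/mm_leP; split=> //.
by rewrite invgM mulgA mulgVK.
Qed.

Lemma out_act_simplex o s :
  order_complex (MM G) s -> order_complex (MM G) (out_act o @` s).
Proof.
case=> fs [c sc] ch; split; [exact: finite_image| by exists (out_act o c), c|].
move=> _ _ [x sx <-] [y sy <-]; rewrite /Order.comparable.
by case/orP: (ch x y sx sy) => /(out_act_le o) ->; rewrite ?orbT.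
Qed.

(** The vertex type is the invariant separating orbits of vertices. *)
Definition mm_type c : vertex_type G := (repr c).2.

Lemma mm_type_class g T : mm_type (mm_class (act_basis g (std_basis G)) T) = T.
Proof.
rewrite /mm_type; set c := mm_class _ _.
have : mm_class (repr c).1 (repr c).2 = c.
  by rewrite -[RHS]reprK /mm_class -surjective_pairing.
case: (repr c) => X U /=; have [h ->] := basis_std X.
by rewrite /c => /mm_classP[].
Qed.

Lemma mm_type_act o c : mm_type (out_act o c) = mm_type c.
Proof.
elim/quotW: o => k; elim/mm_ind: c => g T.
by rewrite out_act_class !mm_type_class.
Qed.

Lemma mm_type_inj_le c d : (c <= d)%O -> mm_type c = mm_type d -> c = d.
Proof.
elim/mm_ind: c => f T; elim/mm_ind: d => g U; rewrite !mm_type_class.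
by move=> /mm_leP[_ fg] TU; apply/mm_classP; rewrite TU.
Qed.

Lemma chain_type_inj s c d : order_complex (MM G) s -> s c -> s d ->
  mm_type c = mm_type d -> c = d.
Proof.
case=> _ _ ch sc sd cd.
case/orP: (ch c d sc sd) => /mm_type_inj_le; first exact.
by move=> e; apply/esym/e.
Qed.

Lemma order_complex_min s : order_complex (MM G) s ->
  exists2 c, s c & forall d, s d -> (c <= d)%O.
Proof.
case=> /finite_seqP[r ->] [c0 c0r] ch.
elim: r c0 c0r ch => [//|c [|d r] IH] c0 _ ch.
  by exists c; rewrite /= ?inE // => d; rewrite /= inE => /eqP->.
have [||m mr mP] := IH d; rewrite /= ?inE ?eqxx //.
  by move=> x y xr yr; apply: ch; rewrite /= inE ?xr ?yr orbT.
have [||cm|mc] := orP (ch c m _ _); rewrite /= ?inE ?eqxx //.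
- by move: mr; rewrite /= inE => ->; rewrite orbT.
- exists c; rewrite /= ?inE ?eqxx // => x; rewrite /= inE => /orP[/eqP->//|/mP].
  exact: le_trans.
- exists m; first by rewrite /= inE mr orbT.
  by move=> x; rewrite /= inE => /orP[/eqP->//|/mP].
Qed.

(** The classes above [f(V), T] can all be written with the marking f: the
    definition of the order only provides some common marking, but the change of
    marking carried by T is carried by all larger vertex types. *)
Lemma class_above f T d : (mm_class (act_basis f (std_basis G)) T <= d)%O ->
  d = mm_class (act_basis f (std_basis G)) (mm_type d).
Proof.
elim/mm_ind: d => g U; rewrite mm_type_class => /mm_leP[_ fg].
apply/mm_classP; split=> //; have := vt_carriesV fg.
by rewrite invgM invgK.
Qed.

Lemma out_act_stab k f T :
  out_act (\pi_(SPOut G) k) (mm_class (act_basis f (std_basis G)) T) =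
    mm_class (act_basis f (std_basis G)) T <-> vt_carries T (f^-1 * k * f).
Proof.
rewrite out_act_class; split=> [/mm_classP[_ /vt_carriesV]|kT].
  by rewrite !invgM !invgK mulgA.
apply/mm_classP; split=> //; have := vt_carriesV kT.
by rewrite !invgM !invgK mulgA.
Qed.

(** Types are preserved and distinct along a chain, so stabilizing the chain
    amounts to fixing all its vertices; fixing the least one suffices because
    the types above it carry more. *)
Lemma stabilizerE s f T : order_complex (MM G) s ->
    s (mm_class (act_basis f (std_basis G)) T) ->
    (forall d, s d -> (mm_class (act_basis f (std_basis G)) T <= d)%O) ->
  stabilizer (@out_act G) s =
  [set o | exists2 k, vt_carries T (f^-1 * k * f) & o = \pi_(SPOut G) k].
Proof.
set c := mm_class _ _ => os sc cs; apply/seteqP; split; elim/quotW=> k.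
  move=> ks; exists k => //; apply/out_act_stab.
  apply: (chain_type_inj os) => //.
    by rewrite -[X in X _]ks; exists c.
  exact: mm_type_act.
case=> k' kT ->; have fixs d : s d -> out_act (\pi_(SPOut G) k') d = d.
  move=> /cs cd; rewrite (class_above cd); apply/out_act_stab.
  apply: vt_carries_le kT; have := cd; rewrite {1}(class_above cd).
  by move=> /mm_leP[].
apply/seteqP; split=> [_ [d sd <-]|d sd]; first by rewrite fixs.
by exists d => //; apply: fixs.
Qed.

Lemma stabilizer_free_abelian s :
  order_complex (MM G) s -> free_abelian (stabilizer (@out_act G) s).
Proof.
move=> os; have [c sc cs] := order_complex_min os.
elim/mm_ind: c sc cs => f T sc cs; rewrite (stabilizerE os sc cs).
exact: free_abelian_carried.
Qed.

(** * The fundamental domain *)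

Lemma wh_vertexE T : wh_vertex T = mm_class (act_basis 1 (std_basis G)) T.
Proof. by rewrite /wh_vertex act_basis1. Qed.

Lemma mm_type_wh T : mm_type (wh_vertex T) = T.
Proof. by rewrite wh_vertexE mm_type_class. Qed.

Lemma wh_vertex_le T U : (wh_vertex T <= wh_vertex U)%O = (T <= U)%O.
Proof.
rewrite !wh_vertexE; apply/idP/idP => [/mm_leP[]//|TU].
by apply/mm_leP; split=> //; rewrite mulVg; apply: vt_carries1.
Qed.

Lemma wh_vertex_iso : simplicial_iso (order_complex (vertex_type G))
  (wh_subcomplex G) (@wh_vertex G).
Proof.
split.
- exact: can_inj mm_type_wh.
- move=> s [fs [T sT] ch]; split; last by move=> _ [U sU <-]; exists U.
  split; [exact: finite_image | by exists (wh_vertex T), T|].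
  move=> _ _ [U sU <-] [V sV <-].
  by rewrite /Order.comparable !wh_vertex_le; apply: ch.
- move=> t [[ft [c tc] ch] tW].
  have tE d : t d -> wh_vertex (mm_type d) = d.
    by move=> /tW[T _ <-]; rewrite mm_type_wh.
  exists (mm_type @` t); last first.
    apply/seteqP; split=> [_ [_ [d td <-] <-]|d td]; first by rewrite tE.
    by exists (mm_type d); [exists d | apply: tE].
  split; [exact: finite_image | by exists (mm_type c), c |].
  move=> _ _ [d td <-] [e te <-].
  by rewrite /Order.comparable -!wh_vertex_le !tE //; apply: ch.
Qed.

Lemma wh_subcomplexP : subcomplex (wh_subcomplex G) (order_complex (MM G)).
Proof.
split=> [s []//|s t [[fs _ ch] sW] t0 ts]; split; last exact: subset_trans sW.
split=> //; first exact: sub_finite_set fs.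
by move=> x y /ts sx /ts sy; apply: ch.
Qed.

Variable R : realType.
Implicit Types x y : MM G -> R.

Lemma act_point_supp o x :
  [set v | act_point (@out_act G) o x v != 0%R] =
  out_act o @` [set v | x v != 0%R].
Proof.
rewrite /act_point; apply/seteqP; split=> [v /= xv|_ [v /= xv <-] /=].
  by exists (out_act o^-1 v); rewrite ?out_actKV.
by rewrite out_actK.
Qed.

Lemma act_pointM o1 o2 x : act_point (@out_act G) (o1 * o2) x =
  act_point (@out_act G) o1 (act_point (@out_act G) o2 x).
Proof. by apply/funext => v; rewrite /act_point invgM out_actM. Qed.

Lemma act_pointK o x :
  act_point (@out_act G) o^-1 (act_point (@out_act G) o x) = x.
Proof. by apply/funext => v; rewrite /act_point invgK out_actK. Qed.

Lemma wh_translate s : order_complex (MM G) s ->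
  exists o, out_act o @` s `<=` range (@wh_vertex G).
Proof.
move=> os; have [c sc cs] := order_complex_min os.
elim/mm_ind: c sc cs => f T sc cs.
exists (\pi_(SPOut G) f^-1) => _ [d /cs/class_above-> <-].
by exists (mm_type d) => //; rewrite out_act_class mulVg -wh_vertexE.
Qed.

(** A vertex supporting x and its translate, which supports the translated
    point, both lie in the Whitehead subcomplex and have the same type, so they
    are equal: every vertex supporting x is fixed. *)
Lemma wh_point_unique o x :
    realization R (wh_subcomplex G) x ->
    realization R (wh_subcomplex G) (act_point (@out_act G) o x) ->
  act_point (@out_act G) o x = x.
Proof.
move=> [_ [_ xW] _] [_ [_ oxW] _]; apply/funext => v.
have wh_fix w : x w != 0%R -> out_act o w = w.
  move=> xw; have [T _ Tw] := xW _ xw.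
  have [|U _ Uw] := oxW (out_act o w); first by rewrite /= /act_point out_actK.
  rewrite -Uw -Tw; congr wh_vertex.
  by rewrite -[LHS]mm_type_wh Uw mm_type_act -Tw mm_type_wh.
rewrite /act_point; case: (boolP (x v == 0%R)) => [/eqP xv|xv]; last first.
  by rewrite -{1}(wh_fix _ xv) out_actK.
rewrite xv; apply/eqP/negPn/negP => ov; have := wh_fix _ ov.
by rewrite out_actKV => e; rewrite -e xv eqxx in ov.
Qed.

Lemma wh_fundamental_domain :
  fundamental_domain R (order_complex (MM G)) (@out_act G) (wh_subcomplex G).
Proof.
split=> [|x [x0 xs x1]]; first exact: wh_subcomplexP.
have [o oW] := wh_translate xs.
have yR : realization R (wh_subcomplex G) (act_point (@out_act G) o x).
  split=> [v||]; first exact: x0.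
    by rewrite act_point_supp; split=> //; apply: out_act_simplex.
  rewrite -x1; apply/esym/(reindex_fsbigT (out_act o^-1)).
  by exists (out_act o); [apply: out_actKV | apply: out_actK].
exists (act_point (@out_act G) o x); split; first by split=> //; exists o.
move=> z [zR [o' zE]].
have {}zE : z = act_point (@out_act G) (o' * o^-1) (act_point (@out_act G) o x).
  by rewrite act_pointM act_pointK.
by rewrite zE in zR *; rewrite (wh_point_unique yR zR).
Qed.

End Action.

Theorem theoremA (R : realType) (G : sgraph) :
  [/\ simplicial_action (order_complex (MM G)) (@out_act G),
      forall s : set (MM G), order_complex (MM G) s ->
        free_abelian (stabilizer (@out_act G) s),
      simplicial_iso (order_complex (vertex_type G)) (wh_subcomplex G)
        (@wh_vertex G) &
      fundamental_domain R (order_complex (MM G)) (@out_act G)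
        (wh_subcomplex G)].
Proof.
split.
- by split; [apply: out_act_group | move=> o s; apply: out_act_simplex].
- exact: stabilizer_free_abelian.
- exact: wh_vertex_iso.
- exact: wh_fundamental_domain.
Qed.
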